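(* Consider the semidefinite program $$z^{\mathrm{SDP}}=\min_{Y\in\mathcal Y}\; Q^0\bullet Y\quad\text{s.t.}\quad Q^k\bullet Y\le 0,\ k=1,\dots,m,\qquad Y\in\mathcal S^+. \quad (\mathrm{SDP})$$ Assume that $z^{\mathrm{SDP}}$ is finite and that (SDP) satisfies Slater's condition relative to its affine constraints, i.e. there is a positive definite $Y\in\mathcal Y$ with $Q^k\bullet Y\le0$ for $k=1,\dots,m$. Let $S^*\succeq 0$ be the PSD slack matrix of an optimal dual solution of (SDP), let $r=\operatorname{rank}(S^* )$, and let $S^*=\sum_{t=1}^r v_tv_t^\top$ with $v_t\in\mathbb R^{n+1}$. Let $V^1,\dots,V^\tau\in\mathcal S(E)$ be the coefficient matrices of the linear inequalities $V^t\bullet Y\ge0$ obtained by using Fourier–Motzkin elimination to project out the variables $Y_{ij}$, $(i,j)\notin E$, from the formulation $$\min_{Y\in\mathcal Y}\; Q^0\bullet Y\quad\text{s.t.}\quad Q^k\bullet Y\le 0,\ k=1,\dots,m,\qquad (v_tv_t^\top)\bullet Y\ge0,\ t=1,\dots,r$$ (in which the variables being eliminated occur only in the last group of constraints). Then: (i) $V^t\in\mathcal S^+\cap\mathcal S(E)$ for $t=1,\dots,\tau$. (ii) Consequently the bound $z^{\mathrm{SDP\text{-}E}}$ can be attained with at most $|E|$ $E$-sparse PSD cuts: there are $p\le|E|$ matrices $C_1,\dots,C_p\in\mathcal S^+\cap\mathcal S(E)$ such that $$z^{\mathrm{SDP\text{-}E}}=\min_{Y\in\mathcal Y}\Bigl\{Q^0\bullet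 Y:\ Q^k\bullet Y\le0,\ k=1,\dots,m;\ \ C_s\bullet Y\ge0,\ s=1,\dots,p;\ \ Y_{ij}=0\ \forall(i,j)\notin E\Bigr\}.$$
   Context: All matrices are real symmetric of size $(n+1)\times(n+1)$ with rows and columns indexed by $0,1,\dots,n$. $\mathcal S$ is the space of such matrices, $\mathcal S^+\subset\mathcal S$ the cone of positive semidefinite ones, and $A\bullet B=\operatorname{tr}(B^\top A)$. Data: for $k=0,\dots,m$, a symmetric $n\times n$ matrix $\bar Q^k$, $c_k\in\mathbb R^n$, $d_k\in\mathbb R$, and $Q^k=\begin{bmatrix} d_k & \tfrac12 c_k^\top\\ \tfrac12 c_k & \bar Q^k\end{bmatrix}\in\mathcal S$. $\mathcal X\subseteq\mathbb R^n$ is a polyhedron (it encodes linear or bound constraints). The sparsity pattern is $$E=\{(i,j)\in\{0,\dots,n\}^2: i=0\text{ or }j=0\text{ or }i=j\text{ or }Q^k_{ij}\ne0\text{ for some }k\in\{0,\dots,m\}\},$$ and $\mathcal S(E)=\{Y\in\mathcal S: Y_{ij}=0\ \forall (i,j)\notin E\}$; $|E|$ is the number of (ordered) pairs in $E$. An $E$-sparse PSD cut is an inequality $C\bullet Y\ge0$ with $C\in\mathcal S^+\cap\mathcal S(E)$. $\mathcal Y$ is the set of $Y\in\mathcal S$ with $Y_{00}=1$ and $(Y_{10},\dots,Y_{n0})^\top\in\mathcal X$. It may in addition include finitely many linear inequality constraints on $Y$ whose coefficient matrices lie in $\mathcal S(E)$. $z^{\mathrm{SDP\text{-}E}}$ is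 the optimal value of $$\min_{Y\in\mathcal Y}\{Q^0\bullet Y:\ Q^k\bullet Y\le 0,\ k=1,\dots,m;\ \ C\bullet Y\ge 0\ \forall C\in\mathcal S^+\cap\mathcal S(E);\ \ Y_{ij}=0\ \forall (i,j)\notin E\}.$$ The PSD slack matrix $S^*\succeq0$ of an optimal dual solution of (SDP) is an optimal multiplier for the constraint $Y\succeq0$, i.e. $S^*\in\mathcal S^+$ with $z^{\mathrm{SDP}}=\inf\{Q^0\bullet Y-S^*\bullet Y:\ Y\in\mathcal Y,\ Q^k\bullet Y\le0,\ k=1,\dots,m\}$. Optimal values are understood as infima. *)

(* Defs.v *)
From HB Require Import structures.
From mathcomp Require Export all_boot all_order all_algebra.
From mathcomp Require Export sesquilinear.
From mathcomp Require Export boolp classical_sets reals constructive_ereal ereal.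

Set Implicit Arguments.
Unset Strict Implicit.
Unset Printing Implicit Defensive.

Import Order.TTheory GRing.Theory Num.Theory.

Local Open Scope ring_scope.
Local Open Scope classical_set_scope.

Section Matrices.
Variables (R : realType) (n : nat).
Implicit Types A B : 'M[R]_n.

Definition frob A B : R := \tr (B^T *m A).

Definition psd A : Prop :=
  A \is symmetricmx /\ forall x : 'cV[R]_n, 0 <= (x^T *m A *m x) 0 0.

Definition posdef A : Prop :=
  A \is symmetricmx /\
  forall x : 'cV[R]_n, x != 0 -> 0 < (x^T *m A *m x) 0 0.

Definition sparse (E : {set 'I_n * 'I_n}) A : Prop :=
  A \is symmetricmx /\ forall i j, (i, j) \notin E -> A i j = 0.

Definition polyhedron (X : set 'cV[R]_n) : Prop :=
  exists (p : nat) (G : 'M[R]_(p, n)) (h : 'cV[R]_p),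
    X = [set x | forall i, (G *m x) i 0 <= h i 0].

(* A matrix C in a list stands for the homogeneous inequality frob C Y >= 0 in
   the symmetric unknown Y.  For i < j, Y i j and Y j i are one variable, whose
   coefficient is 2 C i j.  To eliminate it, keep the inequalities not involving
   it, and add up every pair with coefficients of opposite signs, each scaled
   to make that entry 1, resp. -1.  An inequality (homogeneous or not) in which
   the variable does not occur is left untouched by the step, so the rest of a
   system can be omitted when the variable does not occur there. *)
Definition fm_step (L : seq 'M[R]_n) (ij : 'I_n * 'I_n) : seq 'M[R]_n :=
  [seq C : 'M[R]_n <- L | C ij.1 ij.2 == 0] ++
  [seq (C ij.1 ij.2)^-1 *: C + (- D ij.1 ij.2)^-1 *: D
     | C : 'M[R]_n <- [seq C : 'M[R]_n <- L | 0 < C ij.1 ij.2],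
       D : 'M[R]_n <- [seq D : 'M[R]_n <- L | D ij.1 ij.2 < 0]].

Definition fourier_motzkin (s : seq ('I_n * 'I_n)) (L : seq 'M[R]_n) :
    seq 'M[R]_n :=
  foldl fm_step L s.

End Matrices.

Section QCQP.
Variables (R : realType) (n m : nat).

Definition dataQ (Qbar : 'I_m.+1 -> 'M[R]_n) (c : 'I_m.+1 -> 'cV[R]_n)
    (d : 'I_m.+1 -> R) (k : 'I_m.+1) : 'M[R]_n.+1 :=
  block_mx (d k)%:M (2^-1 *: (c k)^T)
           (2^-1 *: c k) (Qbar k) : 'M[R]_(1 + n, 1 + n).

Variable Q : 'I_m.+1 -> 'M[R]_n.+1.

Definition pattern : {set 'I_n.+1 * 'I_n.+1} :=
  [set ij : 'I_n.+1 * 'I_n.+1 | [|| ij.1 == ord0, ij.2 == ord0, ij.1 == ij.2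
              | [exists k, Q k ij.1 ij.2 != 0]]]%SET.

(* One representative (i, j), i < j, per variable outside the pattern. *)
Definition eliminated : {set 'I_n.+1 * 'I_n.+1} :=
  [set ij : 'I_n.+1 * 'I_n.+1 | (ij.1 < ij.2)%N && (ij \notin pattern)]%SET.

Definition calY (X : set 'cV[R]_n) (q : nat) (L : 'I_q -> 'M[R]_n.+1)
    (b : 'I_q -> R) : set 'M[R]_n.+1 :=
  [set Y | [/\ Y \is symmetricmx, Y ord0 ord0 = 1,
               X (\col_(i < n) Y (lift ord0 i) ord0)
             & forall l, frob (L l) Y <= b l]].

Variable YY : set 'M[R]_n.+1.

(* Index ord0 is the objective; lift ord0 k, k : 'I_m, are the constraints. *)
Definition base : set 'M[R]_n.+1 :=
  [set Y | YY Y /\ forall k : 'I_m, frob (Q (lift ord0 k)) Y <= 0].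

(* Optimal values are infima in \bar R, so an infeasible problem has +oo. *)
Definition optval (F : set 'M[R]_n.+1) (obj : 'M[R]_n.+1 -> R) : \bar R :=
  ereal_inf [set (obj Y)%:E | Y in F].

Definition zSDP : \bar R :=
  optval [set Y | base Y /\ psd Y] (fun Y => frob (Q ord0) Y).

Definition offpattern0 (Y : 'M[R]_n.+1) : Prop :=
  forall i j, (i, j) \notin pattern -> Y i j = 0.

Definition zSDPE : \bar R :=
  optval [set Y | [/\ base Y,
                      forall C, psd C -> sparse pattern C -> 0 <= frob C Y
                    & offpattern0 Y]]
         (fun Y => frob (Q ord0) Y).

Definition zcuts (p : nat) (C : 'I_p -> 'M[R]_n.+1) : \bar R :=
  optval [set Y | [/\ base Y, forall s, 0 <= frob (C s) Y & offpattern0 Y]]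
         (fun Y => frob (Q ord0) Y).

Definition slater : Prop := exists2 Y, base Y & posdef Y.

Definition dual_slack (S : 'M[R]_n.+1) : Prop :=
  psd S /\ zSDP = optval base (fun Y => frob (Q ord0) Y - frob S Y).

End QCQP.

(* Main.v *)
Require Import Defs.
From mathcomp Require Import all_boot all_order all_algebra.
From mathcomp Require Import sesquilinear.
From mathcomp Require Import boolp classical_sets reals constructive_ereal ereal.
From mathcomp Require Import ring.

Set Implicit Arguments.
Unset Strict Implicit.
Unset Printing Implicit Defensive.

Import Order.TTheory GRing.Theory Num.Theory.
Local Open Scope ring_scope.

(** (i) The initial inequalities [v v^T] of the elimination are PSD, and each
    Fourier-Motzkin step only forms nonnegative combinations of earlier
    inequalities, so it stays inside the convex cone of PSD matrices
    ([fourier_motzkin_cone]).  A step produces zeros at the eliminated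
    position, and matrices with a zero at a given position are again a convex
    cone, hence these zeros persist ([fourier_motzkin_elim]).  After all
    off-pattern variables have been treated, what is left is PSD and sparse.

    (ii) The slack matrix [S] alone is a cut that attains the bound.  The
    constraints other than [Y >= 0] only involve entries in the pattern
    ([base_pattern]), so if [S] had a nonzero entry outside it, the Lagrangian
    [(Q^0 - S) . Y] would be unbounded below, against the finiteness of the
    optimal value.  Hence [S] is itself an [E]-sparse PSD cut
    ([dual_slack_sparse]).  Then
    [zSDP <= zcuts S <= zSDPE <= zSDP]:
    the first inequality is weak duality, since [S . Y >= 0] gives
    [Q^0 . Y >= (Q^0 - S) . Y]; the second holds because [S] is one of the
    cuts defining [zSDPE]; for the third, deleting the off-pattern entries of
    a feasible PSD matrix preserves the objective, the constraints and all
    sparse cuts ([zSDPE_le_zSDP]), which are valid because two PSD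
    matrices have a nonnegative inner product ([frob_psd_ge0]).  One cut suffices, and [|E| >= 1] since
    [(0, 0)] is in [E]. *)

(** * Symmetric matrices, the trace form and the positive semidefinite cone *)

Lemma symmetricmxP (R : realType) (n : nat) (A : 'M[R]_n) :
  reflect (A^T = A) (A \is symmetricmx).
Proof.
have idE (B : 'M[R]_n) : map_mx idfun B = B by apply/matrixP=> i j; rewrite mxE.
by rewrite is_hermitianmxE expr0 scale1r idE eq_sym; apply: eqP.
Qed.

Lemma symmetricmx_entry (R : realType) (n : nat) (A : 'M[R]_n) i j :
  A \is symmetricmx -> A i j = A j i.
Proof. by move/symmetricmxP=> {2}<-; rewrite mxE. Qed.

Lemma frobE (R : realType) (n : nat) (A B : 'M[R]_n) :
  frob A B = \sum_i \sum_j A i j * B i j.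
Proof.
rewrite /frob /mxtrace exchange_big; apply: eq_bigr => j _ /=.
by rewrite mxE; apply: eq_bigr => i _; rewrite mxE mulrC.
Qed.

Lemma frobDl (R : realType) (n : nat) (A B Y : 'M[R]_n) :
  frob (A + B) Y = frob A Y + frob B Y.
Proof. by rewrite /frob mulmxDr mxtraceD. Qed.

Lemma frobZl (R : realType) (n : nat) a (A Y : 'M[R]_n) :
  frob (a *: A) Y = a * frob A Y.
Proof. by rewrite /frob -scalemxAr mxtraceZ. Qed.

Lemma frobDr (R : realType) (n : nat) (A Y Z : 'M[R]_n) :
  frob A (Y + Z) = frob A Y + frob A Z.
Proof. by rewrite /frob linearD mulmxDl mxtraceD. Qed.

Lemma frobZr (R : realType) (n : nat) a (A Y : 'M[R]_n) :
  frob A (a *: Y) = a * frob A Y.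
Proof. by rewrite /frob linearZ -scalemxAl mxtraceZ. Qed.

Lemma frob_delta (R : realType) (n : nat) (A : 'M[R]_n) i j :
  frob A (delta_mx i j) = A i j.
Proof.
rewrite frobE (bigD1 i) //= (bigD1 j) //= mxE !eqxx mulr1.
rewrite [X in _ + X + _]big1 ?addr0 => [|k kj]; last first.
  by rewrite mxE (negPf kj) andbF mulr0.
rewrite big1 ?addr0 // => k ki.
by apply: big1 => l _; rewrite mxE (negPf ki) mulr0.
Qed.

Lemma frob_rank1 (R : realType) (n : nat) (w : 'cV[R]_n) (Y : 'M[R]_n) :
  Y \is symmetricmx -> frob (w *m w^T) Y = (w^T *m Y *m w) 0 0.
Proof.
move=> /symmetricmxP Ysym; rewrite /frob Ysym mulmxA mxtrace_mulC mulmxA.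
by rewrite /mxtrace big_ord1.
Qed.

Lemma psd_rank1 (R : realType) (n : nat) (w : 'cV[R]_n) : psd (w *m w^T).
Proof.
split=> [|x]; first by apply/symmetricmxP; rewrite trmx_mul trmxK.
have -> : x^T *m (w *m w^T) *m x = (w^T *m x)^T *m (w^T *m x).
  by rewrite trmx_mul trmxK !mulmxA.
by rewrite mxE big_ord1 [X in X * _]mxE -expr2 sqr_ge0.
Qed.

Lemma psd_comb (R : realType) (n : nat) a b (A B : 'M[R]_n) :
  0 <= a -> 0 <= b -> psd A -> psd B -> psd (a *: A + b *: B).
Proof.
move=> a0 b0 [/symmetricmxP As Ap] [/symmetricmxP Bs Bp]; split=> [|x].
  by apply/symmetricmxP; rewrite linearD !linearZ /= As Bs.
rewrite mulmxDr mulmxDl -!scalemxAr -!scalemxAl mxE addr_ge0 //.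
  by rewrite mxE mulr_ge0.
by rewrite mxE mulr_ge0.
Qed.

Lemma psd_drsubmx (R : realType) (n : nat) (Y : 'M[R]_(1 + n)) :
  psd Y -> psd (drsubmx Y).
Proof.
move=> [/symmetricmxP Ys Yp]; split=> [|x].
  by apply/symmetricmxP; rewrite trmx_drsub Ys.
have := Yp (col_mx 0 x); rewrite -{1}[Y]submxK tr_col_mx mul_row_block.
by rewrite mul_row_col !trmx0 !mul0mx mulmx0 !add0r.
Qed.

(** Evaluating the quadratic form at [(t, y)] gives a polynomial in [t] whose
    leading coefficient is the corner [a].  Being nonnegative, it has
    [a >= 0]; when [a = 0] it is affine, so its slope [2 u^T y] vanishes for
    every [y]; and its value at [t = - u^T y / a] is the Schur complement.
    With the convention [0^-1 = 0] this last choice covers [a = 0] as well. *)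
Lemma psd_schur (R : realType) (n : nat) (a : R) (u : 'cV[R]_n) (D : 'M[R]_n) :
  psd (block_mx a%:M u^T u D : 'M[R]_(1 + n)) ->
  [/\ 0 <= a, a = 0 -> u = 0 & psd (D - a^-1 *: (u *m u^T))].
Proof.
move=> [/symmetricmxP As Ap].
have Ds : D^T = D.
  by move: As; rewrite tr_block_mx => /eq_block_mx[].
have uy (y : 'cV[R]_n) : (y^T *m u) 0 0 = (u^T *m y) 0 0.
  by rewrite -[y^T *m u]trmxK trmx_mul trmxK mxE.
have form t (y : 'cV[R]_n) :
    0 <= t ^+ 2 * a + 2 * t * (u^T *m y) 0 0 + (y^T *m D *m y) 0 0.
  have := Ap (col_mx t%:M y).
  rewrite tr_col_mx mul_row_block mul_row_col tr_scalar_mx !mul_scalar_mx.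
  rewrite mul_mx_scalar mulmxDl -!scalemxAl.
  have mxDE (M N : 'M[R]_1) : (M + N) 0 0 = M 0 0 + N 0 0 by rewrite mxE.
  have mxZE s (M : 'M[R]_1) : (s *: M) 0 0 = s * M 0 0 by rewrite mxE.
  rewrite !mxDE !mxZE mxDE mxZE uy [a%:M _ _]mxE eqxx mulr1n .
  by congr (is_true (_ <= _)); ring.
have a0 : 0 <= a.
  have := form 1 0.
  by rewrite trmx0 !(mulmx0, mul0mx) mxE mulr0 !addr0 expr1n mul1r.
split=> // [aE|].
- have := form ^~ u; rewrite aE.
  set s := (u^T *m u) 0 0; set e := (u^T *m D *m u) 0 0 => h.
  have s0 : s = 0.
    apply/eqP/negPn/negP => sN0.
    have := h (- (e + 1) / (2 * s)).
    have -> : 2 * (- (e + 1) / (2 * s)) * s = - (e + 1).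
      by field; exact: sN0.
    by rewrite mulr0 add0r opprD addrAC addNr add0r oppr_ge0 ler10.
  apply/matrixP=> i j; rewrite (ord1 j) mxE; apply/eqP.
  rewrite -sqrf_eq0; move: s0; rewrite /s mxE => /eqP.
  rewrite psumr_eq0 => [/allP/(_ i)|k _]; rewrite !mxE -expr2 ?sqr_ge0 //.
  by rewrite mem_index_enum; apply.
- split=> [|y].
    by apply/symmetricmxP; rewrite linearB linearZ /= trmx_mul trmxK Ds.
  have -> : (y^T *m (D - a^-1 *: (u *m u^T)) *m y) 0 0 =
            (y^T *m D *m y) 0 0 - a^-1 * (u^T *m y) 0 0 ^+ 2.
    rewrite mulmxBr mulmxBl -scalemxAr -scalemxAl.
    rewrite [LHS]mxE [X in _ + X]mxE [X in - X]mxE; congr (_ - _ * _).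
    by rewrite mulmxA -(mulmxA (y^T *m u)) mxE big_ord1 uy expr2.
  have := form (- a^-1 * (u^T *m y) 0 0) y.
  have [->|aN0] := eqVneq a 0; congr (is_true (_ <= _)).
    by rewrite invr0; ring.
  by field.
Qed.

(** The PSD cone is contained in its dual.  By induction on the dimension: a
    PSD matrix with corner [a] and first column [w] is [a^-1 w w^T] plus its
    Schur complement bordered by zeros, and [Y] is nonnegative on [w w^T]
    because it is PSD. *)
Lemma frob_psd_ge0 (R : realType) (n : nat) (A Y : 'M[R]_n) :
  psd A -> psd Y -> 0 <= frob A Y.
Proof.
elim: n => [|n IHn] in A Y *; first by rewrite frobE big_ord0.
move: A Y; change (forall A Y : 'M[R]_(1 + n), psd A -> psd Y -> 0 <= frob A Y).
move=> A Y Ap Yp.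
pose a := ulsubmx A 0 0; pose u := dlsubmx A; pose D := drsubmx A.
have AE : A = block_mx a%:M u^T u D.
  rewrite -{1}[A]submxK; congr block_mx; first exact: mx11_scalar.
  by rewrite trmx_dlsub (symmetricmxP _ Ap.1).
clearbody a u D.
have [a0 u0 Sp] := psd_schur (eq_ind _ (@psd R _) Ap _ AE).
pose w : 'cV_(1 + n) := col_mx a%:M u.
have -> : A = a^-1 *: (w *m w^T)
              + block_mx 0 0 0 (D - a^-1 *: (u *m u^T)).
  rewrite {1}AE tr_col_mx mul_col_row scale_block_mx add_block_mx !addr0.
  rewrite tr_scalar_mx !mul_scalar_mx mul_mx_scalar !scale_scalar_mx.
  rewrite [_ *: _ + (_ - _)]addrC subrK !scalerA.
  have [/[dup] /u0 -> ->|aN0] := eqVneq a 0.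
    by rewrite trmx0 !scaler0 !mulr0.
  by rewrite mulrA mulVf // mul1r !scale1r.
rewrite frobDl frobZl frob_rank1 ?(Yp.1) //.
apply: addr_ge0; first by rewrite mulr_ge0 ?invr_ge0 // Yp.2.
set B := (_ - _) in Sp *.
suff -> : frob (block_mx 0 0 0 B) Y = frob B (drsubmx Y).
  exact: IHn Sp (psd_drsubmx Yp).
rewrite /frob -[in LHS](submxK Y) tr_block_mx mulmx_block.
by rewrite !(mulmx0, mul0mx) !add0r mxtrace_block mxtrace0 add0r.
Qed.

(** * Fourier-Motzkin elimination *)

(** A step returns old inequalities and nonnegative combinations of two of
    them, so any convex cone that contains the system keeps containing it. *)
Lemma fm_step_cone (R : realType) (n : nat) (P : 'M[R]_n -> Prop) L ij :
    (forall a b C D, 0 <= a -> 0 <= b -> P C -> P D -> P (a *: C + b *: D)) ->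
  (forall C, C \in L -> P C) -> forall C, C \in fm_step L ij -> P C.
Proof.
move=> Pcone PL C; rewrite mem_cat => /orP[|].
  by rewrite mem_filter => /andP[_ /PL].
case/allpairsP=> -[A B] /= [].
rewrite !mem_filter => /andP[A0 /PL PA] /andP[B0 /PL PB] ->.
by apply: Pcone => //; rewrite invr_ge0 ?oppr_ge0 ltW.
Qed.

Lemma fourier_motzkin_cone (R : realType) (n : nat) (P : 'M[R]_n -> Prop) s L :
    (forall a b C D, 0 <= a -> 0 <= b -> P C -> P D -> P (a *: C + b *: D)) ->
  (forall C, C \in L -> P C) -> forall C, C \in fourier_motzkin s L -> P C.
Proof.
move=> Pcone; elim: s L => // ij s IHs L PL.
by apply: IHs; apply: fm_step_cone.
Qed.

Lemma fm_step_elim (R : realType) (n : nat) (L : seq 'M[R]_n) ij C :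
  C \in fm_step L ij -> C ij.1 ij.2 = 0.
Proof.
rewrite mem_cat => /orP[|].
  by rewrite mem_filter => /andP[/eqP].
case/allpairsP=> -[A B] /= [].
rewrite !mem_filter => /andP[A0 _] /andP[B0 _] ->.
by rewrite !mxE mulVf ?gt_eqF // invrN mulNr mulVf ?lt_eqF // subrr.
Qed.

(** Matrices with a zero at a given position form a cone, so an eliminated
    variable does not reappear in later steps. *)
Lemma fourier_motzkin_elim (R : realType) (n : nat) (L : seq 'M[R]_n) s ij C :
  ij \in s -> C \in fourier_motzkin s L -> C ij.1 ij.2 = 0.
Proof.
elim: s L => // kl s IHs L; rewrite inE => /predU1P[->|]; last exact: IHs.
rewrite /fourier_motzkin /= -/(fourier_motzkin s (fm_step L kl)).
apply: (fourier_motzkin_cone (P := fun B => B kl.1 kl.2 = 0)) => [a b A B _ _ A0 B0|].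
  by rewrite !mxE A0 B0 !mulr0 addr0.
exact: fm_step_elim.
Qed.

(** * The sparsity pattern *)

Lemma dataQ_sym (R : realType) (n m : nat) (Qbar : 'I_m.+1 -> 'M[R]_n) c d k :
  Qbar k \is symmetricmx -> dataQ Qbar c d k \is symmetricmx.
Proof.
move=> /symmetricmxP Qs; apply/symmetricmxP.
suff : (dataQ Qbar c d k : 'M_(1 + n))^T = dataQ Qbar c d k by [].
by rewrite /dataQ tr_block_mx tr_scalar_mx !linearZ /= trmxK Qs.
Qed.

Lemma pattern_sym (R : realType) (n m : nat) (Q : 'I_m.+1 -> 'M[R]_n.+1) i j :
    (forall k, Q k \is symmetricmx) ->
  ((i, j) \in pattern Q) = ((j, i) \in pattern Q).
Proof.
move=> Qs; rewrite !inE /= orbCA (eq_sym i j).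
by under eq_existsb => k do rewrite (symmetricmx_entry _ _ (Qs k)).
Qed.

Lemma sparse_data (R : realType) (n m : nat) (Q : 'I_m.+1 -> 'M[R]_n.+1) k :
  Q k \is symmetricmx -> sparse (pattern Q) (Q k).
Proof.
move=> Qs; split=> // i j; rewrite inE /= !negb_or => /and4P[_ _ _].
by rewrite negb_exists => /forallP/(_ k)/negPn/eqP.
Qed.

Lemma frob_sparse_eq (R : realType) (n : nat) E (A Y Z : 'M[R]_n) :
    sparse E A -> (forall i j, (i, j) \in E -> Z i j = Y i j) ->
  frob A Z = frob A Y.
Proof.
move=> [_ A0] YZ; rewrite !frobE; apply: eq_bigr => i _; apply: eq_bigr => j _.
by have [/YZ->|/A0->] := boolP ((i, j) \in E); rewrite ?mul0r.
Qed.

(** All constraints other than positive semidefiniteness only see the entries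
    in the pattern: this is where the first row and column being in the
    pattern matters, since they carry [Y_00 = 1] and the polyhedron. *)
Lemma base_pattern (R : realType) (n m : nat) (Q : 'I_m.+1 -> 'M[R]_n.+1)
    (X : set 'cV[R]_n) (q : nat) (L : 'I_q -> 'M[R]_n.+1) (b : 'I_q -> R) (Y Z : 'M[R]_n.+1) :
    (forall k, Q k \is symmetricmx) -> (forall l, sparse (pattern Q) (L l)) ->
    Z \is symmetricmx ->
    (forall i j, (i, j) \in pattern Q -> Z i j = Y i j) ->
  base Q (calY X L b) Y -> base Q (calY X L b) Z.
Proof.
move=> Qs Lsp Zs ZY [[_ Y00 YX YL] YQ]; split=> [|k]; last first.
  by rewrite (frob_sparse_eq (sparse_data (Qs _)) ZY).
split=> // [||l].
- by rewrite ZY // inE eqxx.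
- suff -> : \col_i Z (lift ord0 i) ord0 = \col_i Y (lift ord0 i) ord0 by [].
  by apply/matrixP=> i j; rewrite !mxE ZY // inE.
- by rewrite (frob_sparse_eq (Lsp l) ZY).
Qed.

(** * Optimal values *)

Lemma optval_le (R : realType) (n : nat) (F G : set 'M[R]_n.+1)
    (f g : 'M[R]_n.+1 -> R) :
    (forall Y, G Y -> exists2 Z, F Z & f Z <= g Y) ->
  (optval F f <= optval G g)%E.
Proof.
move=> FG; apply: le_ereal_inf_tmp => _ [Y /FG[Z FZ fg] <-].
apply: (@le_trans _ _ (f Z)%:E); last by rewrite lee_fin.
by apply: ereal_inf_lbound; exists Z.
Qed.

(** Were [S i j != 0] outside the pattern, the Lagrangian [Q^0 - S] would have
    a nonzero coefficient on a variable on which the constraints [base] do not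
    depend, and its infimum would be [-oo].  Finiteness of the dual bound thus
    forces the multiplier itself to be sparse. *)
Lemma dual_slack_sparse (R : realType) (n m : nat) (Q : 'I_m.+1 -> 'M[R]_n.+1)
    (X : set 'cV[R]_n) (q : nat) (L : 'I_q -> 'M[R]_n.+1) (b : 'I_q -> R) S :
  let YY := calY X L b in
    (forall k, Q k \is symmetricmx) -> (forall l, sparse (pattern Q) (L l)) ->
    zSDP Q YY \is a fin_num -> (exists Y, base Q YY Y) ->
    dual_slack Q YY S -> sparse (pattern Q) S.
Proof.
move=> YY Qs Lsp zfin [Y BY] [[Ss _] zE]; split=> // i j ijE.
apply/eqP/negPn/negP => Sij.
have jiE : (j, i) \notin pattern Q by rewrite -pattern_sym.
pose z := fine (zSDP Q YY).
(* the step at which the Lagrangian takes the value z - 1 *)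
pose t := (frob (Q ord0) Y - frob S Y - z + 1) / (2 * S i j).
pose Z := Y + t *: (delta_mx i j + delta_mx j i).
have ZY k l : (k, l) \in pattern Q -> Z k l = Y k l.
  move=> klE.
  have kl0 i' j' : (i', j') \notin pattern Q -> (k == i') && (l == j') = false.
    by move=> /negP N; apply/negP => /andP[/eqP ki /eqP lj]; rewrite ki lj in klE.
  by rewrite !mxE !kl0 // addr0 mulr0 addr0.
have Zs : Z \is symmetricmx.
  case: BY => -[/symmetricmxP Ys _ _ _] _; apply/symmetricmxP.
  by rewrite linearD linearZ /= linearD /= !trmx_delta Ys [X in _ *: X]addrC.
have BZ : base Q YY Z by apply: base_pattern ZY BY.
have : (zSDP Q YY <= (frob (Q ord0) Z - frob S Z)%:E)%E.
  by rewrite zE; apply: ereal_inf_lbound; exists Z.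
have -> : frob (Q ord0) Z = frob (Q ord0) Y.
  exact: frob_sparse_eq (sparse_data (Qs _)) ZY.
rewrite -(fineK zfin) lee_fin -/z /Z frobDr frobZr frobDr !frob_delta.
rewrite (symmetricmx_entry j i Ss).
have -> : t * (S i j + S i j) = frob (Q ord0) Y - frob S Y - z + 1.
  by rewrite /t; field.
have -> : frob (Q ord0) Y - (frob S Y + (frob (Q ord0) Y - frob S Y - z + 1))
          = z - 1 by ring.
by rewrite lerBrDr -lerBrDl subrr ler10.
Qed.

(** A feasible PSD matrix need not vanish outside the pattern.  Zeroing those
    entries may destroy positive semidefiniteness, but it leaves unchanged the
    objective, [base] and the value of every sparse PSD cut, and that value is
    nonnegative because it can be computed on the original matrix. *)
Lemma zSDPE_le_zSDP (R : realType) (n m : nat) (Q : 'I_m.+1 -> 'M[R]_n.+1)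
    (X : set 'cV[R]_n) (q : nat) (L : 'I_q -> 'M[R]_n.+1) (b : 'I_q -> R) :
    (forall k, Q k \is symmetricmx) -> (forall l, sparse (pattern Q) (L l)) ->
  (zSDPE Q (calY X L b) <= zSDP Q (calY X L b))%E.
Proof.
move=> Qs Lsp; apply: optval_le => Y [BY Yp].
pose Z := \matrix_(i, j) if (i, j) \in pattern Q then Y i j else 0.
have ZY i j : (i, j) \in pattern Q -> Z i j = Y i j by rewrite mxE => ->.
exists Z; last first.
  by rewrite (frob_sparse_eq (sparse_data (Qs _)) ZY).
split=> [|C Cp Csp|i j /negPf ijE]; last by rewrite mxE ijE.
- apply: base_pattern ZY BY => //; apply/symmetricmxP/matrixP=> i j.
  by rewrite !mxE pattern_sym // (symmetricmx_entry j i Yp.1).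
- by rewrite (frob_sparse_eq Csp ZY) frob_psd_ge0.
Qed.

Unset Implicit Arguments.

Theorem lemma3 (R : realType) (n m : nat)
    (Qbar : 'I_m.+1 -> 'M[R]_n) (c : 'I_m.+1 -> 'cV[R]_n) (d : 'I_m.+1 -> R)
    (hQbar : forall k, Qbar k \is symmetricmx)
    (X : set 'cV[R]_n) (hX : polyhedron X)
    (q : nat) (L : 'I_q -> 'M[R]_n.+1) (b : 'I_q -> R) :
  let Q := dataQ Qbar c d in
  let E := pattern Q in
  let YY := calY X L b in
  forall (hL : forall l, sparse E (L l))
    (hfin : zSDP Q YY \is a fin_num)
    (hslater : slater Q YY)
    (S : 'M[R]_n.+1) (hS : dual_slack Q YY S)
    (r : nat) (hr : r = \rank S)
    (v : 'I_r -> 'cV[R]_n.+1) (hv : S = \sum_(t < r) v t *m (v t)^T)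
    (order : seq ('I_n.+1 * 'I_n.+1))
    (horder : perm_eq order (enum (eliminated Q)))
    (tau : nat) (V : tau.-tuple 'M[R]_n.+1)
    (hV : tval V = fourier_motzkin order [seq v t *m (v t)^T | t <- enum 'I_r]),
  (forall t : 'I_tau, psd (tnth V t) /\ sparse E (tnth V t)) /\
  (exists2 p : nat, (p <= #|E|)%N &
     exists2 C : 'I_p -> 'M[R]_n.+1,
       forall s, psd (C s) /\ sparse E (C s) &
       zSDPE Q YY = zcuts Q YY C).
Proof.
move=> Q E YY hL hfin [Y0 BY0 _] S hS r hr v hv order horder tau V hV.
have Qs k : Q k \is symmetricmx by apply: dataQ_sym.
split=> [t|].
  have : tnth V t \in fourier_motzkin order [seq v t *m (v t)^T | t <- enum 'I_r].
    by rewrite -hV mem_tnth.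
  move: (tnth V t) => {t} C CV.
  have Cp : psd C.
    move: C CV; apply: fourier_motzkin_cone => [a' b' A B|C /mapP[t _ ->]].
      exact: psd_comb.
    exact: psd_rank1.
  have C0 (i j : 'I_n.+1) : (i < j)%N -> (i, j) \notin E -> C i j = 0.
    move=> ij ijE; apply: (fourier_motzkin_elim (ij := (i, j)) _ CV).
    by rewrite (perm_mem horder) mem_enum inE /= ij.
  split=> //; split=> [|i j ijE]; first exact: Cp.1.
  case: (ltngtP i j) => [ij|ji|/val_inj ij]; first exact: C0.
    by rewrite (symmetricmx_entry _ _ Cp.1) C0 // -pattern_sym.
  by move: ijE; rewrite ij !inE /= eqxx !orbT.
have Ssp : sparse E S by apply: dual_slack_sparse hS => //; exists Y0.
exists 1%N.
  by apply/card_gt0P; exists (ord0, ord0); rewrite inE eqxx.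
exists (fun=> S) => [_|]; first by split=> //; exact: hS.1.
apply/le_anti/andP; split.
  apply: le_trans (zSDPE_le_zSDP _ _ Qs hL) _.
  (* weak duality: on the cut, Q^0 dominates the Lagrangian Q^0 - S *)
  rewrite hS.2; apply: optval_le => Y [BY SY _]; exists Y => //.
  by rewrite gerBl; exact: SY ord0.
apply: optval_le => Y [BY CY Y0E]; exists Y => //; split=> // _.
exact: CY hS.1 Ssp.
Qed.
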